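(* Let $\mathbb{K}$ be a field of characteristic $0$ and let $n,r$ be non-negative integers with $n\geq r$ and $n\geq 2$. Then the Lie algebra $\left(Mat(n,\mathbb{K}),[\cdot,\cdot]_{J_{n,r}}\right)$ is a contraction of $\mathfrak{gl}(n,\mathbb{K})$.
   Context: $Mat(n,\mathbb{K})$ is the space of $n\times n$ matrices over $\mathbb{K}$, and $\mathfrak{gl}(n,\mathbb{K})$ is $Mat(n,\mathbb{K})$ with the commutator bracket $[A,B]=AB-BA$. For $J\in Mat(n,\mathbb{K})$, $[A,B]_J=AJB-BJA$. $J_{n,r}\in Mat(n,\mathbb{K})$ is the block matrix $\begin{pmatrix} I_r&0\\0&0\end{pmatrix}$. Contraction: let $\mu$ and $\mu_0$ be Lie brackets on the same finite-dimensional $\mathbb{K}$-vector space $V$. One says that $(V,\mu_0)$ is a contraction of $(V,\mu)$ if there is a family $(U_\varepsilon)_{\varepsilon\in\mathbb{K}\setminus\{0\}}$ of invertible linear maps $U_\varepsilon:V\to V$ such that $\lim_{\varepsilon\to 0}U_\varepsilon^{-1}\mu(U_\varepsilon x,U_\varepsilon y)=\mu_0(x,y)$ for all $x,y\in V$. Over a general field $\mathbb{K}$ of characteristic $0$ this is understood algebraically: the matrix entries of $U_\varepsilon$ (in a fixed basis of $V$) are polynomial in $\varepsilon$, the coordinates of $U_\varepsilon^{-1}\mu(U_\varepsilon x,U_\varepsilon y)$ are, for each $x,y$, given by polynomials in $\varepsilon$ for $\varepsilon\neq 0$, and the limit means the value of these polynomials at $\varepsilon=0$. *)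

(* Defs.v *)
From mathcomp Require Import all_boot all_order all_algebra.
Set Implicit Arguments.
Unset Strict Implicit.
Unset Printing Implicit Defensive.
Import GRing.Theory.
Local Open Scope ring_scope.

Definition is_lie_bracket (K : fieldType) (V : lmodType K) (mu : V -> V -> V) :
    Prop :=
  [/\ bilinear_for *:%R *:%R mu,
      forall x, mu x x = 0
    & forall x y z, mu x (mu y z) + mu y (mu z x) + mu z (mu x y) = 0].

(* Polynomiality is expressed in the basis [vbasis {:V}] of V; a change of basis
   has constant coefficients, so nothing below depends on this choice.
   A family over K \ {0} is a function on K whose value at 0 is ignored. *)
Definition polynomial_limit0 (K : fieldType) (V : vectType K)
    (f : K -> V) (v : V) : Prop :=
  exists q : 'I_(\dim {:V}) -> {poly K},
    (forall (e : K) i, e != 0 -> coord (vbasis {:V}) i (f e) = (q i).[e]) /\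
    (forall i, coord (vbasis {:V}) i v = (q i).[0]).

Definition polynomial_family (K : fieldType) (V : vectType K)
    (U : K -> 'End(V)) : Prop :=
  exists P : 'M[{poly K}]_(\dim {:V}),
    forall (e : K) (i j : 'I_(\dim {:V})), e != 0 ->
      coord (vbasis {:V}) i (U e (vbasis {:V})`_j) = (P i j).[e].

(* (V, mu0) is a contraction of (V, mu). An endomorphism of the
   finite-dimensional V is invertible iff its kernel is 0, and [^-1%VF] is then
   its inverse. *)
Definition is_contraction (K : fieldType) (V : vectType K)
    (mu mu0 : V -> V -> V) : Prop :=
  [/\ is_lie_bracket mu, is_lie_bracket mu0
    & exists U : K -> 'End(V),
      [/\ forall e, e != 0 -> lker (U e) == 0%VS,
          polynomial_family U
        & forall x y,
            polynomial_limit0 (fun e => (U e)^-1%VF (mu (U e x) (U e y)))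
                              (mu0 x y)]].

Definition gl_bracket (K : fieldType) (n : nat) (A B : 'M[K]_n) : 'M[K]_n :=
  A *m B - B *m A.

Definition twisted_bracket (K : fieldType) (n : nat) (J A B : 'M[K]_n) :
    'M[K]_n :=
  A *m J *m B - B *m J *m A.

Definition Jmx (K : fieldType) (n r : nat) : 'M[K]_n := pid_mx r.

(* Main.v *)
(* Right multiplication by an invertible matrix [D] pulls the commutator back to
   the [D]-twisted bracket, since [(A D)(B D) - (B D)(A D) = (A D B - B D A) D].
   For [D = diag(1, .., 1, e, .., e)], with [r] entries [1], this twisted bracket
   is affine in [e] and equals the [J_{n,r}]-twisted one at [e = 0]. *)
Require Import Defs.
From mathcomp Require Import all_boot all_order all_algebra.
From mathcomp Require Import ring.
Import GRing.Theory.
Local Open Scope ring_scope.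

Lemma twisted_bracket_bilinear (K : fieldType) (n : nat) (J : 'M[K]_n) :
  bilinear_for *:%R *:%R (twisted_bracket J).
Proof.
split=> [B a x y | A a x y]; rewrite /twisted_bracket /=.
  by rewrite !mulmxDl !mulmxDr -!scalemxAl -scalemxAr opprD scalerBr addrACA.
by rewrite !mulmxDl !mulmxDr -!scalemxAl -scalemxAr opprD scalerBr addrACA.
Qed.

(** The product [A *m J *m B] is associative, and the bracket is its commutator. *)
Lemma twisted_bracket_lie (K : fieldType) (n : nat) (J : 'M[K]_n) :
  is_lie_bracket (twisted_bracket J).
Proof.
split=> [|A|A B C]; first exact: twisted_bracket_bilinear.
  exact: subrr.
rewrite /twisted_bracket !(mulmxBl, mulmxBr) !mulmxA !opprB.
(* Each of the six triple products occurs twice, with opposite signs. Treated as atoms, they cancel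
   entrywise, where [ring] applies over the commutative [K]. *)
move: (A *m J *m B *m J *m C) (A *m J *m C *m J *m B).
move: (B *m J *m C *m J *m A) (B *m J *m A *m J *m C).
move: (C *m J *m A *m J *m B) (C *m J *m B *m J *m A) => CAB CBA BCA BAC ABC ACB.
by apply/matrixP=> i j; rewrite !mxE; ring.
Qed.

Lemma gl_bracketE (K : fieldType) (n : nat) (A B : 'M[K]_n) :
  gl_bracket A B = twisted_bracket 1%:M A B.
Proof. by rewrite /twisted_bracket !mulmx1. Qed.

Lemma gl_bracket_lie (K : fieldType) (n : nat) : is_lie_bracket (@gl_bracket K n).
Proof.
have [[linl linr] alt jac] := @twisted_bracket_lie K n 1%:M.
split=> [|A|A B C]; last by rewrite !gl_bracketE.
  split=> [B a x y|A a x y]; rewrite !gl_bracketE.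
    exact: linl.
  exact: linr.
by rewrite gl_bracketE.
Qed.

Lemma gl_bracket_mulmxr (K : fieldType) (n : nat) (D A B : 'M[K]_n) :
  gl_bracket (A *m D) (B *m D) = twisted_bracket D A B *m D.
Proof. by rewrite /gl_bracket /twisted_bracket mulmxBl !mulmxA. Qed.

Lemma twisted_bracketDZ (K : fieldType) (n : nat) (a : K) (J C A B : 'M[K]_n) :
  twisted_bracket (J + a *: C) A B =
  twisted_bracket J A B + a *: twisted_bracket C A B.
Proof.
rewrite /twisted_bracket !mulmxDr !mulmxDl -!scalemxAr -!scalemxAl.
by rewrite opprD scalerBr addrACA.
Qed.

(** The two matrices are idempotents with sum [1] and products [0], so inverting the coefficient [e]
    inverts the combination. *)
Lemma pid_copid_unitmx (K : fieldType) (n r : nat) (e : K) :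
  (r <= n)%N -> e != 0 -> pid_mx r + e *: copid_mx r \in @unitmx K n.
Proof.
move=> le_rn e0.
suff: (pid_mx r + e *: copid_mx r) *m (pid_mx r + e^-1 *: copid_mx r) = 1%:M
    :> 'M[K]_n by case/mulmx1_unit.
rewrite !mulmxDl !mulmxDr -!scalemxAr -!scalemxAl.
rewrite pid_mx_id // copid_mx_id // mul_pid_mx_copid // mul_copid_mx_pid //.
by rewrite !scaler0 addr0 add0r scalerA mulVf // scale1r addrC subrK.
Qed.

Theorem proposition5p1 (K : fieldType) (charK0 : [pchar K] =i pred0)
    (n r : nat) (le_rn : (r <= n)%N) (n_ge2 : (2 <= n)%N) :
  is_contraction (@gl_bracket K n) (twisted_bracket (Jmx K n r)).
Proof.
split; [exact: gl_bracket_lie | exact: twisted_bracket_lie |].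
pose C : 'M[K]_n := copid_mx r; pose D e := Jmx K n r + e *: C.
have D_unit e : e != 0 -> D e \in unitmx by exact: pid_copid_unitmx.
exists (fun e => linfun (mulmxr (D e))).
have kerU e : e != 0 -> lker (linfun (mulmxr (D e) : 'M[K]_n -> _)) == 0%VS.
  move=> e0; apply/lker0P => A B; rewrite !lfunE /=.
  exact: (can_inj (mulmxK (D_unit e e0))).
split=> //.
  pose b := vbasis {:'M[K]_n}.
  exists (\matrix_(i, j) ((coord b i (b`_j *m Jmx K n r))%:P
                          + 'X * (coord b i (b`_j *m C))%:P)).
  move=> e i j _.
  by rewrite lfunE /= mxE !hornerE mulmxDr -scalemxAr linearD linearZ.
move=> A B; pose b := vbasis {:'M[K]_n}.
(* The constant term is the limit bracket; the slope is the bracket twisted by [C]. *)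
exists (fun i => (coord b i (twisted_bracket (Jmx K n r) A B))%:P
                 + 'X * (coord b i (twisted_bracket C A B))%:P).
split=> [e i e0|i]; last by rewrite !hornerE.
(* The commutator of the images is itself an image under the injective map, so the inverse cancels
   exactly. *)
have -> : gl_bracket (linfun (mulmxr (D e)) A) (linfun (mulmxr (D e)) B)
    = linfun (mulmxr (D e)) (twisted_bracket (D e) A B).
  by rewrite !lfunE /= gl_bracket_mulmxr.
rewrite (lker0_lfunK (kerU e e0)) twisted_bracketDZ.
by rewrite linearD linearZ !hornerE.
Qed.
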